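(* Let $K_n$ be the complete graph on $n$ vertices. The eigenvalues, counted with multiplicity, of the resistance distance matrix of the cartesian product $K_n\times K_2$ are: $\frac{5n^2+2n-4}{n(n+2)}$ (once); $-\frac2n$ ($n-1$ times); $-1$ (once); and $-\frac{2}{n+2}$ ($n-1$ times).
   Context: For a connected graph $G$ with vertices $v_1,\dots,v_m$, Laplacian matrix $L$ (degree matrix minus adjacency matrix) and Moore-Penrose inverse $L^\dagger=(l^\dagger_{ij})$, the resistance distance is $r_{ij}=l^\dagger_{ii}+l^\dagger_{jj}-2l^\dagger_{ij}$, and the resistance distance matrix is $R(G)=(r_{ij})_{m\times m}$. The cartesian product $G_1\times G_2$ has vertex set $V(G_1)\times V(G_2)$, with $(v_1,u_1)$ and $(v_2,u_2)$ adjacent if $v_1=v_2$ and $u_1u_2\in E(G_2)$, or $u_1=u_2$ and $v_1v_2\in E(G_1)$. *)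

(* Defs.v *)
From HB Require Import structures.
From mathcomp Require Import all_boot all_order all_algebra.

Set Implicit Arguments.
Unset Strict Implicit.
Unset Printing Implicit Defensive.

Import Order.TTheory GRing.Theory Num.Theory.
Local Open Scope ring_scope.

Record sgraph := SGraph {
  vertex :> finType;
  adj : rel vertex;
  adj_sym : symmetric adj;
  adj_irr : irreflexive adj
}.

Definition complete_adj (n : nat) : rel 'I_n := fun i j => i != j.

Lemma complete_sym n : symmetric (@complete_adj n).
Proof. by move=> i j; rewrite /complete_adj eq_sym. Qed.

Lemma complete_irr n : irreflexive (@complete_adj n).
Proof. by move=> i; rewrite /complete_adj eqxx. Qed.

Definition complete_graph (n : nat) : sgraph :=
  SGraph (@complete_sym n) (@complete_irr n).

Definition cart_adj (G H : sgraph) : rel (G * H)%type := fun x y =>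
  ((x.1 == y.1) && adj x.2 y.2) || ((x.2 == y.2) && adj x.1 y.1).

Lemma cart_sym (G H : sgraph) : symmetric (@cart_adj G H).
Proof.
move=> x y; rewrite /cart_adj (eq_sym x.1) (eq_sym x.2).
by rewrite (adj_sym x.1) (adj_sym x.2).
Qed.

Lemma cart_irr (G H : sgraph) : irreflexive (@cart_adj G H).
Proof. by move=> x; rewrite /cart_adj !adj_irr !andbF. Qed.

Definition cart_product (G H : sgraph) : sgraph :=
  SGraph (@cart_sym G H) (@cart_irr G H).

(* Matrices of G are indexed by 'I_#|G|; index i stands for the vertex
   enum_val i. *)

Section GraphMatrices.
Variables (R : realFieldType) (G : sgraph).

Definition degree (x : G) : nat := #|[set y : G | adj x y]|.

Definition degree_mx : 'M[R]_#|G| :=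
  diag_mx (\row_i (degree (enum_val i))%:R).

Definition adjacency_mx : 'M[R]_#|G| :=
  \matrix_(i, j) (adj (enum_val i) (enum_val j))%:R.

Definition laplacian : 'M[R]_#|G| := degree_mx - adjacency_mx.

End GraphMatrices.

Section MoorePenrose.
Variables (R : realFieldType) (m n : nat).

Definition is_MP_inverse (A : 'M[R]_(m, n)) (X : 'M[R]_(n, m)) : Prop :=
  [/\ A *m X *m A = A, X *m A *m X = X,
      (A *m X)^T = A *m X & (X *m A)^T = X *m A].

(* Full-rank factorization A = C *m F; mathcomp's pinvmx is only a partial
   inverse, not the Moore-Penrose one. *)
Definition MP_inverse (A : 'M[R]_(m, n)) : 'M[R]_(n, m) :=
  let C := col_base A in let F := row_base A in
  F^T *m invmx (F *m F^T) *m (invmx (C^T *m C) *m C^T).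

End MoorePenrose.

Lemma gram_unit (R : realFieldType) (r n : nat) (F : 'M[R]_(r, n)) :
  row_free F -> F *m F^T \in unitmx.
Proof.
move=> freeF; rewrite -row_free_unit -kermx_eq0; apply/rowV0P => v.
move/sub_kermxP => vFF.
have vF0 : v *m F = 0.
  have: (v *m F) *m (v *m F)^T = 0.
    by rewrite trmx_mul mulmxA -(mulmxA v) vFF mul0mx.
  move: (v *m F) => w /matrixP /(_ 0 0); rewrite !mxE => /eqP.
  rewrite psumr_eq0 => [/allP w0 | j _]; last by rewrite mxE -expr2 sqr_ge0.
  apply/rowP => j; apply/eqP; rewrite [X in _ == X]mxE -sqrf_eq0 expr2.
  by have := w0 j (mem_index_enum j); rewrite mxE.
by apply: (row_free_inj freeF); rewrite vF0 mul0mx.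
Qed.

Lemma full_rank_MP_inverse (R : realFieldType) (m r n : nat)
    (C : 'M[R]_(m, r)) (F : 'M[R]_(r, n)) :
  C^T *m C \in unitmx -> F *m F^T \in unitmx ->
  is_MP_inverse (C *m F)
    (F^T *m invmx (F *m F^T) *m (invmx (C^T *m C) *m C^T)).
Proof.
move=> uC uF; rewrite /is_MP_inverse.
set P := invmx (F *m F^T); set Q := invmx (C^T *m C).
have tP : P^T = P by rewrite trmx_inv trmx_mul trmxK.
have tQ : Q^T = Q by rewrite trmx_inv trmx_mul trmxK.
have AX : C *m F *m (F^T *m P *m (Q *m C^T)) = C *m Q *m C^T.
  rewrite !mulmxA -(mulmxA C F) -(mulmxA C _ P) mulmxV //.
  by rewrite mulmx1.
have XA : F^T *m P *m (Q *m C^T) *m (C *m F) = F^T *m P *m F.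
  rewrite !mulmxA -(mulmxA _ C^T C) -(mulmxA _ Q) mulVmx //.
  by rewrite mulmx1.
split.
- by rewrite AX mulmxA -(mulmxA _ C^T C) -(mulmxA _ Q) mulVmx // mulmx1.
- rewrite XA !mulmxA -(mulmxA _ F F^T) -(mulmxA _ _ P) mulmxV //.
  by rewrite mulmx1.
- by rewrite AX !trmx_mul trmxK tQ mulmxA.
- by rewrite XA !trmx_mul trmxK tP mulmxA.
Qed.

Lemma MP_inverseP (R : realFieldType) (m n : nat) (A : 'M[R]_(m, n)) :
  is_MP_inverse A (MP_inverse A).
Proof.
rewrite -[X in is_MP_inverse X _](mulmx_base A).
apply: full_rank_MP_inverse; last by apply: gram_unit; exact: row_base_free.
rewrite -{2}[col_base A]trmxK; apply: gram_unit.
by rewrite /row_free mxrank_tr; exact: col_base_full.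
Qed.

Lemma MP_inverse_uniq (R : realFieldType) (m n : nat) (A : 'M[R]_(m, n))
    (X : 'M[R]_(n, m)) :
  is_MP_inverse A X -> X = MP_inverse A.
Proof.
have := MP_inverseP A; move: (MP_inverse A) => Y [y1 y2 y3 y4] [x1 x2 x3 x4].
have AXY : A *m X = A *m Y.
  have e : A *m X = (A *m Y) *m (A *m X) by rewrite mulmxA y1.
  by rewrite -x3 e trmx_mul x3 y3 mulmxA x1.
have XYA : X *m A = Y *m A.
  have e : X *m A = (X *m A) *m (Y *m A) by rewrite -mulmxA (mulmxA A) y1.
  by rewrite -x4 e trmx_mul x4 y4 -mulmxA (mulmxA A) x1.
by rewrite -x2 XYA -mulmxA AXY mulmxA y2.
Qed.

Definition resistance_mx (R : realFieldType) (G : sgraph) : 'M[R]_#|G| :=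
  let D := MP_inverse (laplacian R G) in
  \matrix_(i, j) (D i i + D j j - 2%:R * D i j).

(* s lists the eigenvalues of A with (algebraic) multiplicity; for symmetric
   real A this is also the geometric one. *)
Definition eigenvalues_are (R : realFieldType) (n : nat) (A : 'M[R]_n)
    (s : seq R) : Prop :=
  char_poly A = \prod_(x <- s) ('X - x%:P).

(* Main.v *)
Require Import Defs.
From HB Require Import structures.
From mathcomp Require Import all_boot all_order all_algebra.
From mathcomp Require Import perm ring.
Import Order.TTheory GRing.Theory Num.Theory.
Local Open Scope ring_scope.

(** In [K_n x K_2] two vertices are adjacent exactly when they share one
    coordinate but not both, so that [L = (n + 2) I - S1 - S2], where [S1] and
    [S2] are the 0/1 matrices of the relations of having the same first, resp.
    second, coordinate.  With [J] the all-ones matrix, [S1 S1 = 2 S1],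
    [S2 S2 = n S2] and [S1 S2 = S2 S1 = J], so the Moore-Penrose inverse can
    be sought as [p I + q S1 + r S2 + s J]: a symmetric [X] annihilated by [J]
    is the Moore-Penrose inverse of the symmetric [L], itself annihilated by
    [J], as soon as [L X = I - c J] for some [c] ([MP_inverse_centering]).
    This yields [p = 1 / (n + 2)], [q = p / n], [r = p / 2].  The diagonal of
    [X] is constant, so the resistance matrix is
    [2 ((p + q + r) J - p I - q S1 - r S2)].

    Listing the vertices of one copy of [K_n] before those of the other, it
    becomes a block matrix [[A, B], [B, A]], whose characteristic polynomial
    is the product of those of [A + B] and [A - B] ([char_poly_block_sym]).
    Both of these have the form [a I + b J], with eigenvalues [a] ([n - 1]
    times) and [a + n b] (once) ([char_poly_scalar_const]). *)

(** * Determinants and characteristic polynomials *)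

Lemma det_mxsub_bij (R : comNzRingType) (m p : nat) (f : 'I_p -> 'I_m)
    (A : 'M[R]_m) :
  bijective f -> \det (mxsub f f A) = \det A.
Proof.
move=> bf; have := bij_eq_card bf; rewrite !card_ord => epm.
case: m / epm f A bf => f A bf.
pose s := perm (bij_inj bf).
have -> : mxsub f f A = row_perm s (col_perm s A).
  by apply/matrixP => i j; rewrite !mxE !permE.
rewrite row_permE col_permE !det_mulmx !det_perm mulrC -mulrA odd_permV.
by rewrite -expr2 sqrr_sign mulr1.
Qed.

Lemma char_poly_mxsub_bij (R : comNzRingType) (m p : nat) (f : 'I_p -> 'I_m)
    (A : 'M[R]_m) :
  bijective f -> char_poly (mxsub f f A) = char_poly A.
Proof.
move=> bf; rewrite /char_poly -(det_mxsub_bij _ _ _ _ (char_poly_mx A) bf).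
by congr (\det _); apply/matrixP => i j; rewrite !mxE (inj_eq (bij_inj bf)).
Qed.

(** Subtracting the first block row from the second, then adding the second
    block column to the first, makes the matrix block upper triangular. *)
Lemma det_block_sym (R : comNzRingType) (n : nat) (A B : 'M[R]_n) :
  \det (block_mx A B B A) = \det (A + B) * \det (A - B).
Proof.
have <- : \det (block_mx (A + B) B 0 (A - B)) = \det (A + B) * \det (A - B).
  exact: det_ublock.
have -> : block_mx (A + B) B 0 (A - B) =
    block_mx 1%:M 0 (- 1%:M) 1%:M *m block_mx A B B A *m
    block_mx 1%:M 0 1%:M 1%:M.
  rewrite !mulmx_block !(mul0mx, mul1mx, mulmx0, mulmx1, mulNmx, addr0, add0r).
  by congr block_mx; [rewrite addrA addrK addNr | rewrite addrC].
by rewrite !det_mulmx !det_lblock !det1 !mul1r mulr1.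
Qed.

Lemma char_poly_block_sym (R : comNzRingType) (n : nat) (A B : 'M[R]_n) :
  char_poly (block_mx A B B A) = char_poly (A + B) * char_poly (A - B).
Proof.
rewrite /char_poly /char_poly_mx map_block_mx scalar_mx_block opp_block_mx.
rewrite add_block_mx !add0r det_block_sym.
by rewrite map_mxD map_mxB !opprD opprK !addrA.
Qed.

(** The determinant of a rank-one update of a scalar matrix.  The factor [a]
    on the left makes the formula hold for [n = 0] and for [a] not a unit. *)
Lemma det_scalar_rank1 (R : comNzRingType) (n : nat) (a : R) (u : 'cV[R]_n)
    (v : 'rV[R]_n) :
  a * \det (a%:M + u *m v) = a ^+ n * (a + (v *m u) 0 0).
Proof.
(* Both sides compute the determinant of the product of the bordered matrix
   [[1, -v], [u, a I]] with a block triangular matrix of determinant [a]. *)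
have e1 : \det (block_mx (1%:M : 'M_1) (- v) u a%:M) = \det (a%:M + u *m v).
  have <- : \det (block_mx (1%:M : 'M_1) (- v) u a%:M *m
                  block_mx 1%:M v 0 1%:M) =
            \det (block_mx (1%:M : 'M_1) (- v) u a%:M).
    by rewrite det_mulmx det_ublock !det1 !mulr1.
  rewrite mulmx_block !(mulmx1, mul1mx, mulmx0, addr0) subrr det_lblock det1.
  by rewrite mul1r addrC.
have e2 : \det (block_mx (a%:M : 'M_1) 0 (- u) 1%:M) = a.
  by rewrite det_lblock det1 mulr1 det_scalar1.
rewrite -e1 mulrC -[X in _ * X = _]e2 -det_mulmx mulmx_block.
rewrite !(mulmx1, mul1mx, mulmx0, addr0, add0r).
rewrite mulmxN mulNmx opprK mulmxN mul_mx_scalar mul_scalar_mx.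
rewrite subrr det_ublock.
rewrite det_scalar mulrC; congr (_ * _).
by rewrite det_mx11 !mxE eqxx mulr1n.
Qed.

Lemma char_poly_scalar_const (R : idomainType) (n : nat) (a b : R) :
  (0 < n)%N ->
  char_poly (a%:M + const_mx b : 'M[R]_n) =
    ('X - (a + n%:R * b)%:P) * ('X - a%:P) ^+ (n - 1).
Proof.
move=> n_gt0; have nz : 'X - a%:P != 0 by rewrite polyXsubC_eq0.
apply: (mulfI nz); rewrite mulrCA -exprS subn1 prednK // mulrC.
have -> : char_poly (a%:M + const_mx b : 'M[R]_n) =
    \det (('X - a%:P)%:M + const_mx (- b%:P) *m (const_mx 1 : 'rV_n)).
  congr (\det _); apply/matrixP => i j.
  rewrite !mxE big_ord1 !mxE mulr1 raddfD raddfMn /= opprD addrA.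
  by rewrite mulrnBl.
rewrite mulrC det_scalar_rank1 mulrC; congr (_ * _).
rewrite !mxE; under eq_bigr => i _ do rewrite !mxE mul1r.
rewrite sumr_const card_ord raddfD /= opprD -addrA; congr (_ + (_ + _)).
by rewrite mulNrn rmorphM rmorph_nat mulr_natl.
Qed.

(** * The Moore-Penrose inverse *)

(** For the Laplacian of a connected graph, [E] is the averaging matrix, all
    of whose entries are the inverse of the number of vertices. *)
Lemma MP_inverse_centering (R : realFieldType) (m : nat) (L X E : 'M[R]_m) :
  L^T = L -> X^T = X -> E^T = E ->
  L *m X = 1%:M - E -> E *m L = 0 -> E *m X = 0 -> MP_inverse L = X.
Proof.
move=> tL tX tE LX EL EX; apply/esym/MP_inverse_uniq.
have XL : X *m L = 1%:M - E.
  by rewrite -[LHS]trmxK trmx_mul tL tX LX linearB /= trmx1 tE.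
split.
- by rewrite LX mulmxBl mul1mx EL subr0.
- by rewrite XL mulmxBl mul1mx EX subr0.
- by rewrite LX linearB /= trmx1 tE.
- by rewrite XL linearB /= trmx1 tE.
Qed.

(** * The coordinate algebra of the graph *)

(** The graph [K_n x K_2], i.e. two copies of [K_n] joined by a perfect
    matching. *)
Definition prism (n : nat) : sgraph :=
  cart_product (complete_graph n) (complete_graph 2).

(** The entry at [(x, y)] of [p I + q S1 + r S2 + s J]. *)
Definition coord_fun (R : nzRingType) (n : nat) (p q r s : R)
    (x y : 'I_n * 'I_2) : R :=
  p * ((x.1 == y.1)%:R * (x.2 == y.2)%:R) + q * (x.1 == y.1)%:R
  + r * (x.2 == y.2)%:R + s.

(** The matrix [p I + q S1 + r S2 + s J], where [S1] and [S2] are the 0/1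
    matrices of having the same first, resp. second, coordinate. *)
Definition coord_mx (R : nzRingType) (n : nat) (p q r s : R) :
    'M[R]_#|prism n| :=
  \matrix_(i, j) coord_fun R n p q r s (enum_val i) (enum_val j).

Lemma sum_delta (R : comNzRingType) (n : nat) (a : 'I_n) (F : 'I_n -> R) :
  \sum_(i < n) (i == a)%:R * F i = F a.
Proof.
rewrite (bigD1 a) //= eqxx mul1r big1 ?addr0 // => i /negPf->.
by rewrite mul0r.
Qed.

Lemma sum_delta1 (R : comNzRingType) (n : nat) (a : 'I_n) :
  \sum_(i < n) (i == a)%:R = 1 :> R.
Proof.
rewrite -[RHS](sum_delta _ _ a (fun=> 1)).
by apply: eq_bigr => i _; rewrite mulr1.
Qed.

Lemma sum_prism (R : comNzRingType) (n : nat) (F : 'I_n * 'I_2 -> R) :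
  \sum_(k < #|prism n|) F (enum_val k) = \sum_(i < n) \sum_(j < 2) F (i, j).
Proof.
rewrite -(big_enum_val (F : prism n -> R)) /= pair_big.
by apply: eq_bigr => -[].
Qed.

Lemma sum_coord_fun1 (R : comNzRingType) (n : nat) (p q r s : R) (b : 'I_2)
    (z : 'I_n * 'I_2) :
  \sum_(i < n) coord_fun R n p q r s (i, b) z =
    (p + n%:R * r) * (b == z.2)%:R + (q + n%:R * s).
Proof.
rewrite !big_split /= !sumr_const card_ord -!mulr_sumr sum_delta.
by rewrite sum_delta1; ring.
Qed.

Lemma sum_coord_fun2 (R : comNzRingType) (n : nat) (p q r s : R) (a : 'I_n)
    (z : 'I_n * 'I_2) :
  \sum_(j < 2) coord_fun R n p q r s (a, j) z =
    (p + 2%:R * q) * (a == z.1)%:R + (r + 2%:R * s).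
Proof.
rewrite !big_split /= !sumr_const card_ord -!mulr_sumr.
by rewrite !sum_delta1; ring.
Qed.

(** The action of a row of [p I + q S1 + r S2 + s J] on a function on the
    vertices. *)
Lemma sum_coord_fun_mul (R : comNzRingType) (n : nat) (p q r s : R)
    (x : 'I_n * 'I_2) (F : 'I_n * 'I_2 -> R) :
  \sum_(a < n) \sum_(b < 2) coord_fun R n p q r s x (a, b) * F (a, b) =
  p * F x + q * (\sum_(b < 2) F (x.1, b)) + r * (\sum_(a < n) F (a, x.2))
  + s * \sum_(a < n) \sum_(b < 2) F (a, b).
Proof.
transitivity (\sum_(a < n) ((a == x.1)%:R *
    (p * (\sum_(b < 2) (b == x.2)%:R * F (a, b)) + q * \sum_(b < 2) F (a, b))
  + (r * (\sum_(b < 2) (b == x.2)%:R * F (a, b))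
     + s * \sum_(b < 2) F (a, b)))).
  apply: eq_bigr => a _; rewrite !mulr_sumr -!big_split /= mulr_sumr.
  rewrite -big_split /=; apply: eq_bigr => b _.
  by rewrite /coord_fun /= (eq_sym a) (eq_sym b); ring.
rewrite !big_split /= sum_delta -!mulr_sumr sum_delta -!addrA.
case: x => [x1 x2] /=; congr (_ + (_ + (_ + _))).
by congr (_ * _); apply: eq_bigr => a _; rewrite sum_delta.
Qed.

Lemma coord_mxM (R : comNzRingType) (n : nat) (p q r s p' q' r' s' : R) :
  coord_mx R n p q r s *m coord_mx R n p' q' r' s' =
  coord_mx R n (p * p') (p * q' + q * p' + 2%:R * q * q')
    (p * r' + r * p' + n%:R * r * r')
    (p * s' + s * p' + q * r' + r * q'
     + 2%:R * (q * s' + s * q') + n%:R * (r * s' + s * r')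
     + 2%:R * n%:R * s * s').
Proof.
apply/matrixP => i j; rewrite !mxE.
set x := enum_val i; set z := enum_val j.
under eq_bigr => k _ do rewrite !mxE.
rewrite (sum_prism _ _ (fun y => coord_fun R n p q r s x y *
                                 coord_fun R n p' q' r' s' y z)).
rewrite (sum_coord_fun_mul _ _ _ _ _ _ _
           (fun y => coord_fun R n p' q' r' s' y z)).
under [X in s * X]eq_bigr => a _ do rewrite sum_coord_fun2.
rewrite sum_coord_fun1 sum_coord_fun2 big_split /= -mulr_sumr.
rewrite sumr_const card_ord.
by rewrite sum_delta1 /coord_fun -mulr_natl; ring.
Qed.

Lemma coord_mx_tr (R : comNzRingType) (n : nat) (p q r s : R) :
  (coord_mx R n p q r s)^T = coord_mx R n p q r s.
Proof.
apply/matrixP => i j; rewrite !mxE /coord_fun.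
by rewrite (eq_sym (enum_val j).1) (eq_sym (enum_val j).2).
Qed.

Lemma coord_mx1 (R : comNzRingType) (n : nat) :
  coord_mx R n 1 0 0 0 = 1%:M.
Proof.
apply/matrixP => i j; rewrite !mxE /coord_fun !mul0r !addr0 mul1r -natrM mulnb.
by rewrite -(inj_eq enum_val_inj).
Qed.

Lemma coord_mxB (R : comNzRingType) (n : nat) (p q r s p' q' r' s' : R) :
  coord_mx R n p q r s - coord_mx R n p' q' r' s' =
  coord_mx R n (p - p') (q - q') (r - r') (s - s').
Proof. by apply/matrixP => i j; rewrite !mxE /coord_fun; ring. Qed.

(** * Resistance distances in the graph *)

Lemma adj_prism (R : comNzRingType) (n : nat) (x y : prism n) :
  (adj x y)%:R = coord_fun R n (- 2%:R) 1 1 0 x y.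
Proof.
case: x y => [a b] [a' b']; rewrite /coord_fun /= /cart_adj /= /complete_adj.
by case: (a == a'); case: (b == b') => /=; ring.
Qed.

Lemma degree_prism (R : comNzRingType) (n : nat) (x : prism n) :
  (degree x)%:R = n%:R :> R.
Proof.
have -> : (degree x)%:R = \sum_(k < #|prism n|) (adj x (enum_val k))%:R :> R.
  rewrite -(big_enum_val (fun y : prism n => (adj x y)%:R)) /=.
  rewrite -natr_sum /degree -sum1_card big_mkcond /=.
  by congr (_%:R); apply: eq_bigr => y _; rewrite inE; case: (adj x y).
under eq_bigr => k _ do rewrite adj_sym adj_prism.
rewrite (sum_prism _ _ (fun y => coord_fun R n (- 2%:R) 1 1 0 y x)).
under eq_bigr => a _ do rewrite sum_coord_fun2.
rewrite big_split /= -mulr_sumr sumr_const card_ord.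
by rewrite sum_delta1 -mulr_natl; ring.
Qed.

Lemma laplacian_prism (R : realFieldType) (n : nat) :
  laplacian R (prism n) = coord_mx R n (n%:R + 2%:R) (- 1) (- 1) 0.
Proof.
have -> : laplacian R (prism n) =
    coord_mx R n n%:R 0 0 0 - coord_mx R n (- 2%:R) 1 1 0.
  congr (_ - _); apply/matrixP => i j; rewrite !mxE.
    rewrite degree_prism -(inj_eq enum_val_inj) /coord_fun !mul0r !addr0.
    by rewrite -natrM mulnb mulr_natr.
  exact: adj_prism.
by rewrite coord_mxB; congr coord_mx; ring.
Qed.

(** The last coefficient makes the rows sum to zero. *)
Lemma MP_inverse_laplacian_prism (R : realFieldType) (n : nat) :
  (0 < n)%N ->
  let p : R := (n%:R + 2%:R)^-1 in let q := p / n%:R in let r := p / 2%:R in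
  MP_inverse (laplacian R (prism n)) =
    coord_mx R n p q r (- (p + 2%:R * q + n%:R * r) / (2%:R * n%:R)).
Proof.
move=> n_gt0 p q r.
have n_neq0 : n%:R != 0 :> R by rewrite pnatr_eq0 -lt0n.
have n2_neq0 : n%:R + 2%:R != 0 :> R by rewrite -natrD pnatr_eq0 addn2.
apply: (MP_inverse_centering _ _ _ _ (coord_mx R n 0 0 0 (2%:R * n%:R)^-1));
  rewrite ?laplacian_prism ?coord_mx_tr // coord_mxM.
- by rewrite -coord_mx1 coord_mxB; congr coord_mx; rewrite /q /r /p; field;
    rewrite ?n_neq0 ?n2_neq0.
(* The zero matrix is put in coordinate form, to compare coefficients. *)
- by rewrite -(subrr (coord_mx R n 0 0 0 0)) coord_mxB; congr coord_mx; field;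
    rewrite ?n_neq0.
- by rewrite -(subrr (coord_mx R n 0 0 0 0)) coord_mxB; congr coord_mx;
    rewrite /q /r /p; field; rewrite ?n_neq0 ?n2_neq0.
Qed.

Lemma resistance_prism (R : realFieldType) (n : nat) :
  (0 < n)%N ->
  let p : R := (n%:R + 2%:R)^-1 in let q := p / n%:R in let r := p / 2%:R in
  resistance_mx R (prism n) =
    coord_mx R n (- 2%:R * p) (- 2%:R * q) (- 2%:R * r)
      (2%:R * (p + q + r)).
Proof.
move=> n_gt0 p q r; rewrite /resistance_mx MP_inverse_laplacian_prism //.
(* The constant coefficient of the Moore-Penrose inverse cancels out. *)
move: (- _ / _) => s.
rewrite -/p -/q -/r; move: p q r => p q r.
by apply/matrixP => i j; rewrite !mxE /coord_fun !eqxx /=; ring.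
Qed.

(** * The spectrum *)

(** The enumeration of the vertices that lists one copy of [K_n] before the
    other: index [i] stands for the vertex [(i, 0)] and index [n + i] for
    [(i, 1)]. *)
Definition copy_order (n : nat) (k : 'I_(n + n)) : 'I_#|prism n| :=
  enum_rank (match split k with
             | inl i => (i, ord0)
             | inr i => (i, ord_max)
             end : prism n).

Lemma copy_order_bij (n : nat) : bijective (copy_order n).
Proof.
apply: inj_card_bij; last by rewrite !card_ord card_prod !card_ord muln2 addnn.
move=> k l /enum_rank_inj e; apply: (can_inj splitK).
by move: e; case: (split k) => i; case: (split l) => j [->].
Qed.

Lemma copy_order_coord_mx (R : comNzRingType) (n : nat) (p q r s : R) :
  mxsub (copy_order n) (copy_order n) (coord_mx R n p q r s) =
  let A := (p + q)%:M + const_mx (r + s) in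
  let B := q%:M + const_mx s in block_mx A B B A.
Proof.
have fl i : copy_order n (lshift n i) = enum_rank ((i, ord0) : prism n).
  by rewrite /copy_order (unsplitK (inl i)).
have fr i : copy_order n (rshift n i) = enum_rank ((i, ord_max) : prism n).
  by rewrite /copy_order (unsplitK (inr i)).
apply/matrixP => k l; rewrite -(splitK k) -(splitK l).
case: (split k) => i; case: (split l) => j; rewrite /unsplit;
  rewrite ?(block_mxEul, block_mxEur, block_mxEdl, block_mxEdr) !mxE;
  rewrite ?fl ?fr !enum_rankK /coord_fun /=;
  by case: (i == j) => /=; ring.
Qed.

Theorem theorem5p3 (R : realFieldType) (n : nat) (hn : (0 < n)%N) :
  eigenvalues_are
    (resistance_mx R (cart_product (complete_graph n) (complete_graph 2)))
    ([:: (5%:R * n%:R ^+ 2 + 2%:R * n%:R - 4%:R) / (n%:R * (n%:R + 2%:R))]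
     ++ nseq (n - 1) (- (2%:R / n%:R))
     ++ [:: -1]
     ++ nseq (n - 1) (- (2%:R / (n%:R + 2%:R)))).
Proof.
have n_neq0 : n%:R != 0 :> R by rewrite pnatr_eq0 -lt0n.
have n2_neq0 : n%:R + 2%:R != 0 :> R by rewrite -natrD pnatr_eq0 addn2.
rewrite /eigenvalues_are -/(prism n) resistance_prism //.
rewrite -(char_poly_mxsub_bij _ _ _ _ _ (copy_order_bij n)).
rewrite copy_order_coord_mx /= char_poly_block_sym.
rewrite big_cons big_cat big_cons /= !big_nseq.
rewrite !iter_mulr_1.
(* [A + B] and [A - B] are again of the form [a I + b J]. *)
have addE (a b c d : R) : a%:M + const_mx b + (c%:M + const_mx d) =
    (a + c)%:M + const_mx (b + d) :> 'M_n.
  by rewrite addrACA -!raddfD.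
have subE (a b c d : R) : a%:M + const_mx b - (c%:M + const_mx d) =
    (a - c)%:M + const_mx (b - d) :> 'M_n.
  by rewrite opprD addrACA -!raddfB.
rewrite addE subE !char_poly_scalar_const // -!mulrA.
by congr (('X - _%:P) * (('X - _%:P) ^+ _ * (('X - _%:P) * ('X - _%:P) ^+ _)));
  field; rewrite ?n_neq0 ?n2_neq0.
Qed.
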